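(* Let $q\ge 2$ be an integer and let $r,m,n$ be positive integers. Let $A\in\mathbb{Z}^{rm\times n}$ be an $\mathrm{RMDS}_q$ matrix all of whose entries lie in a set $\mathcal{Q}=\{q_1,\dots,q_k\}$ of cardinality $k$. If $n>k$, then $r\le k^{k+1}$.
   Context: For an integer $q\ge 2$, a matrix $B\in\mathbb{Z}^{m\times n}$ is an $\mathrm{EQ}_q$ matrix if $Bx=0$ has no non-trivial solution $x\in\{-q+1,\dots,q-1\}^n$. A matrix $A\in\mathbb{Z}^{rm\times n}$ is called $\mathrm{RMDS}_q$ (MDS for $q$-ary bijections) with MDS rate $r$ and EQ rate $n/m$ if every $m\times n$ submatrix of $A$ (formed by choosing any $m$ of its $rm$ rows) is an $\mathrm{EQ}_q$ matrix. *)

(* Defs.v *)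
From mathcomp Require Import all_boot all_order all_algebra.
From mathcomp Require Import finmap.

Set Implicit Arguments.
Unset Strict Implicit.
Unset Printing Implicit Defensive.

Import Order.TTheory GRing.Theory Num.Theory.
Local Open Scope ring_scope.

Definition EQ (q m n : nat) (B : 'M[int]_(m, n)) : Prop :=
  forall x : 'cV[int]_n,
    (forall j, - q%:Z + 1 <= x j 0 <= q%:Z - 1) -> B *m x = 0 -> x = 0.

(* [enum_val] enumerates S in increasing order, so the [rowsub] below is the
   submatrix of A on the rows in S, kept in their original order. *)
Definition RMDS (q r m n : nat) (A : 'M[int]_(r * m, n)) : Prop :=
  forall S : {set 'I_(r * m)}, #|S| = m ->
    EQ q (rowsub (fun i : 'I_#|S| => enum_val i) A).

(* Main.v *)
(** Look only at the first [k + 1] columns: a row then has at most [k ^ (k + 1)]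
    possible values, so if [r] exceeds this number, some [m] rows agree there.
    Their common value has [k + 1] entries from [k] symbols, hence two equal
    entries, at columns [a] and [b]; the vector [e_a - e_b] lies in the kernel of
    the corresponding [m x n] submatrix. *)
Require Import Defs.
From mathcomp Require Import all_boot all_order all_algebra.
From mathcomp Require Import finmap.

Set Implicit Arguments.
Unset Strict Implicit.
Unset Printing Implicit Defensive.

Import Order.TTheory GRing.Theory Num.Theory.
Local Open Scope ring_scope.

(** The fibres partition [T]: if each had fewer than [m] elements, [T] would have at most
    [#|U| * m]. *)
Lemma exists_large_fiber (T U : finType) (f : T -> U) (m : nat) :
  (#|U| * m < #|T|)%N -> exists u, (m <= #|[set t | f t == u]|)%N.
Proof.
move=> ltUT; apply/existsP; apply: contraLR ltUT => /existsPn small.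
rewrite -leqNgt -sum1_card (partition_big f predT) //= -sum_nat_const.
apply: leq_sum => u _; have := small u; rewrite -ltnNge => /ltnW.
by rewrite -sum1_card; under eq_bigl do rewrite inE.
Qed.

Lemma exists_subset_card (T : finType) (A : {set T}) (m : nat) :
  (m <= #|A|)%N -> exists2 S : {set T}, S \subset A & #|S| = m.
Proof.
case/card_geqP=> s [us <- sA]; exists [set:: s].
  by apply/subsetP => x; rewrite inE => /sA.
by rewrite cardsE; apply/card_uniqP.
Qed.

Lemma exists_collision (T U : finType) (f : T -> U) :
  (#|U| < #|T|)%N -> exists a b, a != b /\ f a = f b.
Proof.
move=> ltUT; have /injectivePn[a [b ab eq_f]] : ~~ injectiveb f.
  by apply: contraL ltUT => /injectiveP /leq_card; rewrite -leqNgt.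
by exists a, b.
Qed.

(** Otherwise [x] below is a nonzero kernel vector; its entries lie in {-1, 0, 1}, a range that
    [2 <= q] admits. *)
Lemma EQ_distinct_cols (q m n : nat) (B : 'M[int]_(m, n)) (a b : 'I_n) :
  (2 <= q)%N -> EQ q B -> a != b -> ~ (forall i, B i a = B i b).
Proof.
move=> hq hB ab eqB.
pose x : 'cV[int]_n := delta_mx a 0 - delta_mx b 0.
have x0 : x = 0.
  apply: hB; last first.
    rewrite mulmxBr -!colE; apply/matrixP => i j.
    by rewrite !mxE eqB subrr.
  have q1 : 1 <= q%:Z - 1 by rewrite lerBrDr.
  have q1' : - q%:Z + 1 <= -1 by rewrite -[leLHS]opprK opprD opprK lerN2.
  move=> j; rewrite !mxE !eqxx !andbT.
  by case: (j == a); case: (j == b); rewrite ?subrr ?subr0 ?sub0r;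
    apply/andP; split; rewrite ?(le_trans q1') ?(le_trans _ q1).
by have := congr1 (fun y : 'cV[int]_n => y a 0) x0; rewrite !mxE !eqxx (negbTE ab).
Qed.

Theorem theorem3 (q r m n k : nat) (A : 'M[int]_(r * m, n)) (Q : {fset int})
  (hq : (2 <= q)%N) (hr : (0 < r)%N) (hm : (0 < m)%N) (hn : (0 < n)%N)
  (hA : RMDS q A)
  (hQ : #|` Q|%fset = k)
  (hAQ : forall i j, A i j \in Q)
  (hnk : (k < n)%N) :
  (r <= k ^ k.+1)%N.
Proof.
rewrite leqNgt; apply/negP => ltr.
pose w : 'I_k.+1 -> 'I_n := widen_ord hnk.
(* Values are taken in the finite type [Q], so that [card_ffun] bounds the truncated rows by
   [k ^ k.+1]. *)
pose f i : {ffun 'I_k.+1 -> Q} := [ffun j => [` hAQ i (w j)]%fset].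
have [u] : exists u, (m <= #|[set i | f i == u]|)%N.
  apply: exists_large_fiber.
  by rewrite card_ffun !card_ord -cardfE hQ ltn_pmul2r.
case/exists_subset_card=> S /subsetP Su cardS.
have [a [b [ab uab]]] : exists a b, a != b /\ u a = u b.
  by apply: exists_collision; rewrite card_ord -cardfE hQ.
apply: (EQ_distinct_cols (a := w a) (b := w b) hq (hA S cardS)) => [|i].
  (* [widen_ord] keeps the underlying number, so [w a != w b] is [ab] up to conversion. *)
  exact: ab.
(* Each row of the submatrix comes from [S], hence is sent to [u] by [f]. *)
rewrite !mxE; have := Su _ (enum_valP i); rewrite inE => /eqP fu.
by move: uab; rewrite -fu !ffunE => /(congr1 val).
Qed.
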